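(* Every $\lambda$-homomorphic weak left brace $(S,+,\cdot)$ is a dual weak left brace.
   Context: A semigroup $(S,+)$ (not necessarily commutative) is an inverse semigroup if for each $a\in S$ there is a unique element $-a$ with $a-a+a=a$ and $-a+a-a=-a$; for an inverse semigroup $(S,\cdot)$ written multiplicatively this element is written $a^{-1}$. An inverse semigroup $(S,\cdot)$ is a Clifford semigroup if $a^{-1}a=aa^{-1}$ for all $a$. A weak left brace is a triple $(S,+,\cdot)$ with $(S,+)$ and $(S,\cdot)$ inverse semigroups such that $x(y+z)=xy-x+xz$ and $xx^{-1}=-x+x$ for all $x,y,z\in S$. It is a dual weak left brace if moreover $(S,\cdot)$ is a Clifford semigroup. In a weak left brace let $\lambda_x(y)=-x+xy$. A weak left brace is $\lambda$-homomorphic if $\lambda_x(\lambda_y(z))=\lambda_{x+y}(z)$ for all $x,y,z\in S$, i.e. $-x+x(-y+yz)=-y-x+(x+y)z$. *)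

(* Defs.v *)
From mathcomp Require Import all_boot.

Set Implicit Arguments.
Unset Strict Implicit.
Unset Printing Implicit Defensive.

(* MathComp's additive structures are commutative, and its semigroups carry a
   choice structure; here the carrier is an arbitrary type and neither operation
   is assumed commutative. *)

Definition semigroup_inverse (S : Type) (op : S -> S -> S) (a b : S) : Prop :=
  op (op a b) a = a /\ op (op b a) b = b.

(* The operation [inv] is determined by [op]: [unique P b] says that [b] is the
   only element satisfying [P]. *)
Definition inverse_semigroup
    (S : Type) (op : S -> S -> S) (inv : S -> S) : Prop :=
  associative op /\ forall a, unique (semigroup_inverse op a) (inv a).

Definition clifford_semigroup
    (S : Type) (op : S -> S -> S) (inv : S -> S) : Prop :=
  inverse_semigroup op inv /\ forall a, op (inv a) a = op a (inv a).

Declare Scope brace_scope.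
Delimit Scope brace_scope with brace.

Record weak_left_brace : Type := WeakLeftBrace {
  carrier :> Type;
  add : carrier -> carrier -> carrier;
  opp : carrier -> carrier;
  mul : carrier -> carrier -> carrier;
  inv : carrier -> carrier;
  add_inverse_semigroup : inverse_semigroup add opp;
  mul_inverse_semigroup : inverse_semigroup mul inv;
  mul_addr : forall x y z : carrier,
    mul x (add y z) = add (add (mul x y) (opp x)) (mul x z);
  mul_invr : forall x : carrier, mul x (inv x) = add (opp x) x
}.

Notation "x + y" := (add x y) : brace_scope.
Notation "- x" := (opp x) : brace_scope.
Notation "x - y" := (add x (opp y)) : brace_scope.
Notation "x * y" := (mul x y) : brace_scope.
Notation "x ^-1" := (inv x) : brace_scope.

Local Open Scope brace_scope.

Definition dual_weak_left_brace (S : weak_left_brace) : Prop :=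
  clifford_semigroup (@mul S) (@inv S).

Definition lambda (S : weak_left_brace) (x y : S) : S := - x + x * y.

Definition lambda_homomorphic (S : weak_left_brace) : Prop :=
  forall x y z : S, lambda x (lambda y z) = lambda (x + y) z.

(* Main.v *)
Require Import Defs.
From mathcomp Require Import all_boot.

(** The map [lambda] turns products into compositions, and by hypothesis also
    sums. Put [e = x * x^-1 = - x + x] and [f = x^-1 * x]. Then
    [lambda (- x)] and [lambda x^-1] are both inverses of [lambda x], so
    [lambda e = lambda (- x) \o lambda x] and [lambda f = lambda x^-1 \o lambda x]
    satisfy [lambda e = lambda e \o lambda f] and
    [lambda f = lambda f \o lambda e], hence agree because [e] and [f] commute.
    Finally, an idempotent is determined by its [lambda] map. *)

Set Implicit Arguments.
Unset Strict Implicit.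
Unset Printing Implicit Defensive.

Local Open Scope brace_scope.

Section InverseSemigroup.

Variables (S : Type) (op : S -> S -> S) (inv : S -> S).
Hypothesis invS : inverse_semigroup op inv.

Let opA : associative op. Proof. by case: invS. Qed.

Lemma inverse_semigroupK a : op (op a (inv a)) a = a.
Proof. by case: invS => _ /(_ a) [[]]. Qed.

Lemma inverse_semigroup_uniq a b : semigroup_inverse op a b -> inv a = b.
Proof. by case: invS => _ /(_ a) [_]; apply. Qed.

Lemma idempotent_inv e : op e e = e -> inv e = e.
Proof. by move=> ee; apply: inverse_semigroup_uniq; split; rewrite !ee. Qed.

Lemma inv_involutive a : inv (inv a) = a.
Proof.
by apply: inverse_semigroup_uniq; case: invS => _ /(_ a) [[]].
Qed.

Lemma idempotent_op_inv a : op (op a (inv a)) (op a (inv a)) = op a (inv a).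
Proof. by rewrite opA inverse_semigroupK. Qed.

Lemma idempotent_inv_op a : op (op (inv a) a) (op (inv a) a) = op (inv a) a.
Proof. by have := idempotent_op_inv (inv a); rewrite inv_involutive. Qed.

(** The element [f x e] is also an inverse of [e f], so it equals [x]. This form makes [x]
    idempotent, hence its own inverse, and so equal to [e f]. *)
Lemma idempotent_opM e f :
  op e e = e -> op f f = f -> op (op e f) (op e f) = op e f.
Proof.
move=> ee ff; set x := inv (op e f).
have [efK xK] : semigroup_inverse op (op e f) x.
  by case: invS => _ /(_ (op e f)) [].
have ee' y : op e (op e y) = op e y by rewrite opA ee.
have ff' y : op f (op f y) = op f y by rewrite opA ff.
have defx : x = op f (op x e).
  apply: inverse_semigroup_uniq; split; rewrite -!opA ?ee' ?ff'.
    by rewrite !opA -(opA (op _ x)).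
  by rewrite -[in RHS]xK -!opA.
have xx : op x x = x.
  have xefxe : op x (op e (op f (op x e))) = op x e by rewrite -[in RHS]xK -!opA.
  by rewrite {1 2}defx -!opA xefxe -defx.
by rewrite -[op e f]inv_involutive -/x (idempotent_inv xx).
Qed.

(** Both [e f], being idempotent, and [f e] are inverses of [e f]. *)
Lemma idempotent_opC e f : op e e = e -> op f f = f -> op e f = op f e.
Proof.
move=> ee ff.
have idm := idempotent_opM ee ff; have idm' := idempotent_opM ff ee.
rewrite -[LHS](idempotent_inv idm); apply: inverse_semigroup_uniq.
split; rewrite -!opA.
  by rewrite (opA f f) ff (opA e e) ee -[RHS]idm !opA.
by rewrite (opA e e) ee (opA f f) ff -[RHS]idm' !opA.
Qed.

End InverseSemigroup.

Section WeakLeftBrace.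

Variable S : weak_left_brace.
Implicit Types x y z e f : S.

Let addIS := add_inverse_semigroup S.
Let mulIS := mul_inverse_semigroup S.
Let addA : associative (@Defs.add S). Proof. by case: addIS. Qed.
Let mulA : associative (@Defs.mul S). Proof. by case: mulIS. Qed.

(** By [mul_addr] read backwards, the two inverse laws for the right-hand side reduce to [x] times
    those for [y] and [- y]. *)
Lemma opp_mul x y : - (x * y) = - x + x * (- y) - x.
Proof.
apply: (inverse_semigroup_uniq addIS); split.
  by rewrite !addA -!mul_addr (inverse_semigroupK addIS).
have yK : - y + y - y = - y by case: addIS => _ /(_ y) [[]].
have xyK : x * (- y) - x + x * y - x + x * (- y) = x * (- y).
  by rewrite -!mul_addr yK.
by rewrite -[in RHS]xyK !addA.
Qed.

Lemma lambda_mul x y z : lambda (x * y) z = lambda x (lambda y z).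
Proof. by rewrite /lambda opp_mul mul_addr !addA mulA. Qed.

(** Since [e] is its own multiplicative inverse, [mul_invr] reads [e = - e + e]. *)
Lemma mul_idempotent_add e : e * e = e -> e + e = e.
Proof.
move=> ee; have := idempotent_inv_op addIS e.
by rewrite -mul_invr (idempotent_inv mulIS ee) ee.
Qed.

Lemma lambda_idempotent e z : e * e = e -> lambda e z = e + e * z.
Proof.
by move=> /mul_idempotent_add ee; rewrite /lambda (idempotent_inv addIS ee).
Qed.

(** Evaluating both maps at [f] and at [e] gives [e + f = f] and [f + e = e]; additive idempotents
    commute. *)
Lemma lambda_idempotent_inj e f :
  e * e = e -> f * f = f -> lambda e =1 lambda f -> e = f.
Proof.
move=> ee ff eq_ef.
have eeD := mul_idempotent_add ee; have ffD := mul_idempotent_add ff.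
have := eq_ef e; have := eq_ef f.
rewrite !lambda_idempotent // ee ff eeD ffD => def_f def_e.
have ef : e + f = f by rewrite -[in LHS]def_f addA eeD def_f.
have fe : f + e = e by rewrite [in LHS]def_e addA ffD -def_e.
by rewrite -[LHS]fe (idempotent_opC addIS ffD eeD).
Qed.

End WeakLeftBrace.

Theorem proposition4p4 (S : weak_left_brace) :
  lambda_homomorphic S -> dual_weak_left_brace S.
Proof.
move=> lamD; have addIS := add_inverse_semigroup S.
have mulIS := mul_inverse_semigroup S; split=> // x.
have ee := idempotent_op_inv mulIS x; have ff := idempotent_inv_op mulIS x.
apply: lambda_idempotent_inj => // z.
have lam_e w : lambda (x * x^-1) w = lambda (- x) (lambda x w).
  by rewrite mul_invr lamD.
have xK w : lambda x (lambda (- x) (lambda x w)) = lambda x w.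
  by rewrite !lamD (inverse_semigroupK addIS).
have lam_fe : lambda (x^-1 * x * (x * x^-1)) z = lambda (x^-1 * x) z.
  by rewrite lambda_mul lam_e !(lambda_mul x^-1) xK.
(* With [x * x^-1] moved to the left, its factor [lambda x] absorbs [x^-1 * x], as
   [x * (x^-1 * x) = x]. *)
rewrite -lam_fe (idempotent_opC mulIS ff ee) lambda_mul lam_e.
by rewrite -(lambda_mul x) (proj1 mulIS) (inverse_semigroupK mulIS) -lam_e.
Qed.
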